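(* Let $n=2^rp$, where $p$ is an odd prime and $r\ge 2$. Let $S$ be a sequence in $\mathbb{Z}_n$ which has exactly two odd terms. Then $S$ is a $U(n)$-extremal sequence for the Gao constant if and only if there exist primes $p_1,\ldots,p_r$ with $n=2p_1p_2\cdots p_r$ (in some order), integers $b_1,\ldots,b_r$ with $b_i$ coprime to $p_i$ for each $1\le i\le r$, and an odd integer $m$ with $1\le m\le n$, such that $S$ is $U(n)$-equivalent to the sequence $$(b_1,\ p_1b_2,\ p_1p_2b_3,\ \ldots,\ p_1\cdots p_{r-1}b_r,\ \underbrace{n/2,\ldots,n/2}_{m\text{ times}},\ \underbrace{0,\ldots,0}_{n-m\text{ times}}).$$
   Context: $\mathbb{Z}_n=\mathbb{Z}/n\mathbb{Z}$ and $U(n)$ is its group of units; integers are identified with their images in $\mathbb{Z}_n$. For even $n$, an element of $\mathbb{Z}_n$ is odd if it is the image of an odd integer; terms of a sequence are counted with multiplicity. A sequence is a finite list $(x_1,\ldots,x_l)$ of elements of $\mathbb{Z}_n$ (repetitions allowed); a subsequence is obtained by restricting to a subset of the indices. For $A\subseteq\mathbb{Z}_n$, a subsequence of $(x_1,\ldots,x_l)$ with index set $I$ is an $A$-weighted zero-sum subsequence if $I\ne\emptyset$ and there exist $a_i\in A$ ($i\in I$) with $\sum_{i\in I}a_ix_i=0$. The $A$-weighted Gao constant $E_A(n)$ is the least positive integer $k$ such that every sequence of length $k$ in $\mathbb{Z}_n$ has an $A$-weighted zero-sum subsequence of length $n$. An $A$-extremal sequence for the Gao constant is a sequence in $\mathbb{Z}_n$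 of length $E_A(n)-1$ which has no $A$-weighted zero-sum subsequence of length $n$. For a subgroup $A$ of $U(n)$, two sequences $(x_1,\ldots,x_l)$ and $(y_1,\ldots,y_l)$ in $\mathbb{Z}_n$ are $A$-equivalent if there exist $c\in U(n)$, a permutation $\sigma$ of $\{1,\ldots,l\}$ and $a_1,\ldots,a_l\in A$ such that $c\,y_{\sigma(i)}=a_ix_i$ for all $1\le i\le l$. *)

(* Defs.v *)
From mathcomp Require Import all_boot all_order all_fingroup all_algebra.

Set Implicit Arguments.
Unset Strict Implicit.
Unset Printing Implicit Defensive.

Import Order.TTheory GRing.Theory Num.Theory.
Local Open Scope ring_scope.

(* 'Z_n denotes the ring of integers mod n only for n > 1 ('Z_0 and 'Z_1 are
   both Z/2), so the definitions below are meant for n > 1. *)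

Definition Zn_units (n : nat) : {set 'Z_n} := [set x | x \is a GRing.unit].

(* Parity of the representative in {0, ..., n-1}; see Zn_oddP. *)
Definition Zn_odd (n : nat) (x : 'Z_n) : bool := odd x.

Lemma Zn_oddP (n : nat) (x : 'Z_n) : (1 < n)%N -> ~~ odd n ->
  reflect (exists k : int, odd `|k|%N /\ x = k%:~R) (Zn_odd x).
Proof.
move=> n_gt1 n_even.
have odd_mod m : odd (m %% n) = odd m.
  by rewrite {2}(divn_eq m n) oddD oddM (negbTE n_even) andbF.
have natE m : odd (m%:R : 'Z_n) = odd m by rewrite val_Zp_nat ?odd_mod.
apply: (iffP idP) => [x_odd | [k [k_odd ->]]].
  by exists (Posz (x : 'Z_n)); split=> //; rewrite -pmulrn natr_Zp.
rewrite /Zn_odd; case: k k_odd => m m_odd; first by rewrite -pmulrn natE.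
rewrite NegzE mulrNz -pmulrn.
set y : 'Z_n := m.+1%:R; set z : 'Z_n := - y.
have yz : ((y : nat) + (z : nat))%N%:R = 0 :> 'Z_n.
  by rewrite natrD !natr_Zp subrr.
have := natE (y + z)%N.
rewrite yz oddD natE; move: m_odd => /= ->; by case: (odd z).
Qed.

(* A subsequence of S is given by its set I of indices. *)
Definition weighted_zero_sum (n : nat) (A : {set 'Z_n}) (S : seq 'Z_n)
    (I : {set 'I_(size S)}) : Prop :=
  I != set0 /\
  exists a : 'I_(size S) -> 'Z_n,
    (forall i, i \in I -> a i \in A) /\ \sum_(i in I) a i * S`_i = 0.

Definition has_zero_sum_of_length_n (n : nat) (A : {set 'Z_n})
    (S : seq 'Z_n) : Prop :=
  exists I : {set 'I_(size S)}, weighted_zero_sum A I /\ #|I| = n.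

Definition gao_property (n : nat) (A : {set 'Z_n}) (k : nat) : Prop :=
  forall S : seq 'Z_n, size S = k -> has_zero_sum_of_length_n A S.

(* k = E_A(n) *)
Definition is_gao_constant (n : nat) (A : {set 'Z_n}) (k : nat) : Prop :=
  [/\ (0 < k)%N, gao_property A k
    & forall j : nat, (0 < j)%N -> gao_property A j -> (k <= j)%N].

Definition gao_extremal (n : nat) (A : {set 'Z_n}) (S : seq 'Z_n) : Prop :=
  exists k : nat, [/\ is_gao_constant A k, size S = (k - 1)%N
    & ~ has_zero_sum_of_length_n A S].

(* Meant for A a subgroup of the group of units. *)
Definition weighted_equiv (n : nat) (A : {set 'Z_n}) (S T : seq 'Z_n) : Prop :=
  size S = size T /\
  exists (c : 'Z_n) (s : {perm 'I_(size S)}) (a : 'I_(size S) -> 'Z_n),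
    [/\ c \in Zn_units n, forall i, a i \in A
      & forall i, c * T`_(s i) = a i * S`_i].

(* With indices starting at 0, the i-th of the first r terms is
   q_0 ... q_(i-1) b_i. *)
Definition model_sequence (n r : nat) (q : 'I_r -> nat) (b : 'I_r -> int)
    (m : nat) : seq 'Z_n :=
  [seq (\prod_(j < r | j < i) q j)%N%:R * (b i)%:~R | i : 'I_r <- enum 'I_r]
    ++ nseq m (n %/ 2)%N%:R ++ nseq (n - m)%N 0.

(* Main.v *)
(* Let n = 2^r p. By the Chinese remainder theorem, a set of terms has a
   unit-weighted zero-sum as soon as it has one modulo 2^r and one modulo p.
   Modulo p it suffices that the number of terms prime to p be different from 1.
   Modulo 2^r it suffices that the number of odd terms be even and positive; if
   there is no odd term, halve all terms and go on modulo 2^(r-1). Hence a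
   sequence avoiding such sums has at most one term to be discarded at each
   2-adic level, and the Gao constant is n + r + 1. In an extremal sequence with
   exactly two odd terms, a single term is prime to p: otherwise choose n terms
   among which are both odd ones and either none or at least two prime to p.
   Discarding it, one finds one term of each 2-adic valuation below r - 1, an odd
   number of terms equal to n/2, and zeros: up to order this is already the model
   sequence with (p_1, ..., p_r) = (p, 2, ..., 2). *)
Require Import Defs.
From mathcomp Require Import all_boot all_order all_fingroup all_algebra.
From mathcomp Require Import zify.

Set Implicit Arguments.
Unset Strict Implicit.
Unset Printing Implicit Defensive.

Import Order.TTheory GRing.Theory Num.Theory.

(** * Subsets with prescribed intersection sizes *)

Lemma subset_of_card (X : finType) (A : {set X}) (k : nat) :
  k <= #|A| -> exists2 B : {set X}, B \subset A & #|B| = k.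
Proof.
move=> kA; have : 0 < #|[set B : {set X} | B \subset A & #|B| == k]|.
  by rewrite cards_draws bin_gt0.
by case/card_gt0P=> B; rewrite inE => /andP[BA /eqP Bk]; exists B.
Qed.

Lemma subset_of_card2 (X : finType) (T O : {set X}) (k l : nat) :
  k <= #|T :&: O| -> l <= #|T :\: O| ->
  exists I : {set X}, [/\ I \subset T, #|I :&: O| = k & #|I :\: O| = l].
Proof.
move=> /subset_of_card[A AT Ak] /subset_of_card[B BT Bl].
move: AT BT; rewrite subsetI subsetD => /andP[AT AO] /andP[BT BO].
exists (A :|: B); split; first by rewrite subUset AT.
  by rewrite setIUl (setIidPl AO) (disjoint_setI0 BO) setU0.
by rewrite setDUl (setDidPl BO); move: AO; rewrite -setD_eq0 => /eqP->; rewrite set0U.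
Qed.

(** The sets [O] and [M] cut [T] into four cells from which elements can be chosen independently. In
    the applications [O] collects the odd terms and [M] the terms prime to [p]. *)
Lemma subset_of_card4 (X : finType) (T O M : {set X}) (a b c d : nat) :
  a <= #|T :&: O :&: M| -> b <= #|(T :&: O) :\: M| ->
  c <= #|(T :\: O) :&: M| -> d <= #|(T :\: O) :\: M| ->
  exists I : {set X}, [/\ I \subset T, #|I| = a + b + c + d,
    #|I :&: O| = a + b & #|I :&: M| = a + c].
Proof.
move=> ha hb hc hd.
have [A [AT Aa Ab]] := subset_of_card2 ha hb.
have [B [BT Bc Bd]] := subset_of_card2 hc hd.
move: AT BT; rewrite subsetI subsetD => /andP[AT AO] /andP[BT BO].
have dAB : A :&: B = set0.
  by apply: disjoint_setI0; rewrite (disjointWl AO) // disjoint_sym.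
have cU (P Q : {set X}) : P \subset A -> Q \subset B -> #|P :|: Q| = #|P| + #|Q|.
  move=> PA QB; rewrite cardsU; suff -> : P :&: Q = set0 by rewrite cards0 subn0.
  by apply/eqP; rewrite -subset0 -dAB setISS.
exists (A :|: B); split; first by rewrite subUset AT.
- by rewrite cU // -(cardsID M A) -(cardsID M B) Aa Ab Bc Bd addnA.
- rewrite setIUl (setIidPl AO) (disjoint_setI0 BO) setU0.
  by rewrite -(cardsID M A) Aa Ab.
- by rewrite setIUl cU ?subsetIl // Aa Bc.
Qed.

Lemma even_odds_subset (X : finType) (T O : {set X}) (m : nat) :
  0 < m -> ~~ odd m -> m < #|T| -> 1 < #|T :&: O| ->
  exists I : {set X},
    [/\ I \subset T, #|I| = m, 0 < #|I :&: O| & ~~ odd #|I :&: O|].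
Proof.
move=> m0 mev mT oT; have := cardsID O T => cT.
(* As [m] is even, so is [k]. If [k < m], rounding wastes at most one element of [O], which
   [m < #|T|] allows. *)
pose k := minn m (#|T :&: O|./2).*2.
have [||I [IT Ik Il]] := @subset_of_card2 _ T O k (m - k).
- by rewrite /k; lia.
- by rewrite /k; lia.
have cI := cardsID O I.
by exists I; split => //; rewrite ?Ik /k; lia.
Qed.

(** The choice serves both moduli at once: the even number of elements of [O] yields a sum modulo a
    power of 2, and [#|I :&: M| != 1] one modulo [p]. *)
Lemma even_odds_marked_subset (X : finType) (T O M : {set X}) (m : nat) :
  3 < m -> ~~ odd m -> m.+1 < #|T| -> 1 < #|T :&: O| -> 1 < #|T :&: M| ->
  exists I : {set X}, [/\ I \subset T, #|I| = m, 0 < #|I :&: O|,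
    ~~ odd #|I :&: O| & #|I :&: M| != 1].
Proof.
move=> m3 mev mT oT mkT.
have cT := cardsID O T; have cO := cardsID M (T :&: O).
have cE := cardsID M (T :\: O).
have cM : #|T :&: M| = #|T :&: O :&: M| + #|(T :\: O) :&: M|.
  rewrite -(cardsID O (T :&: M)); congr (_ + _); apply: eq_card => i.
    by rewrite !inE -andbA andbCA andbC andbAC.
  by rewrite !inE andbA.
move: cT cO cE cM.
set a := #|T :&: O :&: M|; set b := #|(T :&: O) :\: M|.
set c := #|(T :\: O) :&: M|; set d := #|(T :\: O) :\: M| => cT cO cE cM.
suff [a' [b' [c' [d' [[ha hb hc hd] hm h0 hodd h1]]]]] :
    exists a' b' c' d', [/\ [/\ a' <= a, b' <= b, c' <= c & d' <= d],
      a' + b' + c' + d' = m, 0 < a' + b', ~~ odd (a' + b') & a' + c' != 1].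
  have [I [IT IE IO IM]] := subset_of_card4 ha hb hc hd.
  by exists I; rewrite IE IO IM.
(* With two marked elements in [O], marked elements are taken first among the [k] chosen from
   [O]. *)
have [a2 | a1] := leqP 2 a.
  pose k := minn m (#|T :&: O|./2).*2.
  exists (minn a k), (k - minn a k), (minn c (m - k)),
    (m - k - minn c (m - k)).
  by split; [split|..]; rewrite /k; lia.
(* Otherwise, if two elements lie outside [O], at least two places are kept for such elements and
   filled with marked ones first; [3 < m] keeps [k] positive. *)
have [ce2 | ce1] := leqP 2 (c + d).
  pose k := minn (m - 2) (#|T :&: O|./2).*2.
  exists a, (k - a), (minn c (m - k)), (m - k - minn c (m - k)).
  by split; [split|..]; rewrite /k; lia.
(* Here at most one element is marked in [O] and at most one lies outside [O], so [m.+1 < #|T|]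
   leaves [m] unmarked elements of [O]. *)
by exists 0, m, 0, 0; split; [split|..]; lia.
Qed.

(** * Odd-weighted zero sums modulo powers of 2 *)

(** For [s > 0] the odd numbers represent the units modulo [2 ^ s]. Terms are natural numbers so
    that they can be halved. *)
Definition odd_weighted_zero_sum (X : finType) (s : nat) (w : X -> nat)
    (I : {set X}) : Prop :=
  exists2 a : X -> nat, (forall i, odd (a i)) & 2 ^ s %| \sum_(i in I) a i * w i.

Definition odd_terms (X : finType) (w : X -> nat) : {set X} :=
  [set i | odd (w i)].

Lemma odd_sum_card (X : finType) (w : X -> nat) (I : {set X}) :
  odd (\sum_(i in I) w i) = odd #|I :&: odd_terms w|.
Proof.
rewrite -sum1_card (big_morph odd oddD (erefl : odd 0 = false)).
rewrite (big_morph odd oddD (erefl : odd 0 = false)).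
rewrite [RHS](eq_bigl (fun i => (i \in I) && odd (w i))); last first.
  by move=> i; rewrite !inE.
by rewrite big_mkcondr; apply: eq_bigr => i _; case: (odd (w i)).
Qed.

Lemma odd_weighted_zero_sum_half (X : finType) (s : nat) (w : X -> nat)
    (I : {set X}) :
  [disjoint I & odd_terms w] ->
  odd_weighted_zero_sum s (fun i => (w i)./2) I -> odd_weighted_zero_sum s.+1 w I.
Proof.
move=> dI [a a_odd sa]; exists a => //.
rewrite (eq_bigr (fun i => 2 * (a i * (w i)./2))); last first.
  move=> i iI; have := disjointFr dI iI; rewrite inE => wi.
  by rewrite mulnCA mul2n -{1}(odd_double_half (w i)) wi.
by rewrite -big_distrr /= expnS dvdn_pmul2l.
Qed.

Lemma coprime_solve_dvdn (u d c : nat) :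
  0 < d -> coprime u d -> exists x : nat, d %| x * u + c.
Proof.
(* Modulo [d], [c * d.-1] is the opposite of [c], so [y] is a multiple of [u] cancelling [c]. *)
move=> d0 cop; pose y := chinese u d 0 (c * d.-1).
exists (y %/ u); rewrite divnK; last by rewrite /dvdn (chinese_modl cop) mod0n.
by rewrite /dvdn -modnDml (chinese_modr cop) modnDml -mulnSr prednK // modnMl.
Qed.

(** All weights are 1 except at one odd term [j]. The other terms have an odd sum, so the weight at
    [j] that cancels it modulo [2 ^ s] must be odd. For [s = 0] the modulus says nothing about
    parity, hence the separate case. *)
Lemma odd_weighted_zero_sum_even (X : finType) (s : nat) (w : X -> nat)
    (I : {set X}) :
  0 < #|I :&: odd_terms w| -> ~~ odd #|I :&: odd_terms w| ->
  odd_weighted_zero_sum s w I.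
Proof.
case: s => [|s]; first by exists (fun=> 1); rewrite ?dvd1n.
case/card_gt0P=> j; rewrite !inE => /andP[jI wj] evI.
pose rest := \sum_(i in I :\ j) w i.
have sumE : \sum_(i in I) w i = w j + rest by rewrite (big_setD1 j).
have odd_rest : odd rest.
  by move: evI; rewrite -odd_sum_card sumE oddD wj /= negbK.
have [||x sx] := @coprime_solve_dvdn (w j) (2 ^ s.+1) rest.
- by rewrite expn_gt0.
- by rewrite coprimeXr // coprimen2.
have odd_x : odd x.
  have : 2 %| x * w j + rest by apply: dvdn_trans sx; rewrite expnS dvdn_mulr.
  by rewrite dvdn2 oddD oddM odd_rest wj andbT addbT negbK.
exists (fun i => if i == j then x else 1); first by move=> i; case: ifP.
rewrite (big_setD1 j) //= eqxx (eq_bigr w) // => i.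
by rewrite !inE => /andP[/negbTE-> _]; rewrite mul1n.
Qed.

Lemma card_setD_odd_terms (X : finType) (w : X -> nat) (T : {set X}) (k l : nat) :
  k + l <= #|T| -> #|T :&: odd_terms w| <= l -> k <= #|T :\: odd_terms w|.
Proof. by move=> kT oT; have := cardsID (odd_terms w) T; lia. Qed.

Lemma disjoint_setD_sub (X : finType) (T O I : {set X}) :
  I \subset T :\: O -> I \subset T /\ [disjoint I & O].
Proof. by rewrite subsetD => /andP[]. Qed.

(** Two odd terms finish by parity; otherwise at most one term is dropped before halving, so [s]
    levels cost at most [s] terms. *)
Lemma odd_weighted_zero_sum_exists (X : finType) (m s : nat) (w : X -> nat)
    (T : {set X}) :
  0 < m -> ~~ odd m -> m + s <= #|T| ->
  exists I : {set X}, [/\ I \subset T, #|I| = m & odd_weighted_zero_sum s w I].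
Proof.
move=> m0 mev; elim: s w T => [|s IHs] w T mT.
  have [I IT Im] := @subset_of_card _ T m ltac:(lia).
  by exists I; split=> //; exists (fun=> 1); rewrite ?dvd1n.
have [o1 | o2] := leqP #|T :&: odd_terms w| 1.
  have := @card_setD_odd_terms _ w T (m + s) 1 ltac:(lia) o1.
  case/(IHs (fun i => (w i)./2)) => I [/disjoint_setD_sub[IT dI] Im zI].
  by exists I; split=> //; apply: odd_weighted_zero_sum_half.
have [I [IT Im I0 Iev]] := even_odds_subset m0 mev (ltac:(lia) : m < #|T|) o2.
by exists I; split=> //; apply: odd_weighted_zero_sum_even.
Qed.

(** The induction is repeated with one spare term. As soon as at most one marked term is left, the
    spare pays for dropping it; while two are left, the choice of [I] can include them or avoid all
    marked terms. *)
Lemma odd_weighted_zero_sum_unmarked_exists (X : finType) (m s : nat)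
    (w : X -> nat) (T M : {set X}) :
  3 < m -> ~~ odd m -> m + s < #|T| ->
  exists I : {set X},
    [/\ I \subset T, #|I| = m, odd_weighted_zero_sum s w I & #|I :&: M| != 1].
Proof.
move=> m3 mev.
have few_marked k w' (T' : {set X}) : #|T' :&: M| <= 1 -> m + k < #|T'| ->
    exists I : {set X},
      [/\ I \subset T', #|I| = m, odd_weighted_zero_sum k w' I & #|I :&: M| != 1].
  move=> M1 mT; have cT := cardsID M T'.
  have [I [/disjoint_setD_sub[IT dI] Im zI]] :=
    @odd_weighted_zero_sum_exists _ m k w' (T' :\: M) ltac:(lia) mev ltac:(lia).
  by exists I; split=> //; rewrite (disjoint_setI0 dI) cards0.
elim: s w T => [|s IHs] w T mT;
  have [M1 | M2] := leqP #|T :&: M| 1; try exact: few_marked.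
- have cT := cardsID M T.
  have [I [IT Ik Il]] := @subset_of_card2 _ T M
    (minn m #|T :&: M|) (m - minn m #|T :&: M|) ltac:(lia) ltac:(lia).
  have cI := cardsID M I.
  exists I; split=> //; [by lia | by exists (fun=> 1); rewrite ?dvd1n | by lia].
have [o1 | o2] := leqP #|T :&: odd_terms w| 1.
  have := @card_setD_odd_terms _ w T (m + s).+1 1 ltac:(lia) o1.
  case/(IHs (fun i => (w i)./2)) => I [/disjoint_setD_sub[IT dI] Im zI IM].
  by exists I; split=> //; apply: odd_weighted_zero_sum_half.
have [I [IT Im I0 Iev IM]] :=
  even_odds_marked_subset m3 mev (ltac:(lia) : m.+1 < #|T|) o2 M2.
by exists I; split=> //; apply: odd_weighted_zero_sum_even.
Qed.

(** * Terms sorted by 2-adic valuation *)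

(** Exact 2-adic valuation [v]; a term equal to 0 lies on no level. *)
Definition level (X : finType) (v : nat) (w : X -> nat) : {set X} :=
  [set i | (2 ^ v %| w i) && ~~ (2 ^ v.+1 %| w i)].

Lemma level0 (X : finType) (w : X -> nat) : level 0 w = odd_terms w.
Proof. by apply/setP=> i; rewrite !inE dvd1n dvdn2 negbK. Qed.

Lemma level_half (X : finType) (v : nat) (w : X -> nat) :
  level v (fun i => (w i)./2) :\: odd_terms w = level v.+1 w.
Proof.
apply/setP=> i; rewrite !inE; have [wi | wi] /= := boolP (odd (w i)).
  have -> // : 2 ^ v.+1 %| w i = false.
  apply/negbTE; apply: contraL wi => wi.
  by rewrite -dvdn2; apply: dvdn_trans wi; rewrite expnS dvdn_mulr.
rewrite -{3 4}(odd_double_half (w i)) (negbTE wi) add0n -mul2n.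
by rewrite !(expnS 2 v.+1) (expnS 2 v) !dvdn_pmul2l // -expnS.
Qed.

(** Two odd terms would give a zero sum by parity, and without odd terms all [m + s] terms could be
    halved, enough for the modulus [2 ^ s]. So exactly one term leaves at each level. At the last
    one only [m] terms remain, whose sum must be odd. *)
Lemma level_structure (X : finType) (m s : nat) (w : X -> nat) (T : {set X}) :
  0 < m -> ~~ odd m -> #|T| = m + s ->
  (forall I : {set X}, I \subset T -> #|I| = m ->
     ~ odd_weighted_zero_sum s.+1 w I) ->
  (forall v, v < s -> #|T :&: level v w| = 1) /\ odd #|T :&: level s w|.
Proof.
move=> m0 mev; elim: s w T => [|s IHs] w T cT noz.
  split=> //; rewrite level0; apply/negP => evT.
  have Tm : #|T| = m by rewrite cT addn0.
  case: (noz T (subxx _) Tm); exists (fun=> 1) => //.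
  rewrite (eq_bigr w) => [|i _]; last by rewrite mul1n.
  by rewrite expn1 dvdn2 odd_sum_card; apply/negP.
have o1 : #|T :&: odd_terms w| = 1.
  apply/eqP; rewrite eqn_leq; apply/andP; split; rewrite leqNgt; apply/negP => oT.
    have [I [IT Im I0 Iev]] := even_odds_subset m0 mev (ltac:(lia) : m < #|T|) oT.
    by case: (noz I IT Im); apply: odd_weighted_zero_sum_even.
  have := @card_setD_odd_terms _ w T (m + s.+1) 0 ltac:(lia) ltac:(lia).
  case/(odd_weighted_zero_sum_exists (fun i => (w i)./2) m0 mev).
  move=> I [/disjoint_setD_sub[IT dI] Im zI].
  by case: (noz I IT Im); apply: odd_weighted_zero_sum_half.
have cT' : #|T :\: odd_terms w| = m + s.
  by have := cardsID (odd_terms w) T; lia.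
case: (IHs (fun i => (w i)./2) _ cT') => [I /disjoint_setD_sub[IT dI] Im zI|].
  by case: (noz I IT Im); apply: odd_weighted_zero_sum_half.
have levE v : (T :\: odd_terms w) :&: level v (fun i => (w i)./2)
    = T :&: level v.+1 w.
  by rewrite -level_half setIDA setIDAC.
move=> lev1; rewrite levE => lev_odd; split=> // -[|v] vs; first by rewrite level0.
by rewrite -levE lev1.
Qed.

(** * Weighted zero sums modulo the odd prime *)

Definition coprime_terms (X : finType) (p : nat) (w : X -> nat) : {set X} :=
  [set i | ~~ (p %| w i)].

(** If two terms [j], [k] are prime to [p], the weight at [k] is chosen so that the sum without [j]
    is nonzero modulo [p]; the weight at [j] cancelling it is then nonzero too. *)
Lemma coprime_weighted_zero_sum (X : finType) (p : nat) (w : X -> nat)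
    (I : {set X}) :
  prime p -> odd p -> #|I :&: coprime_terms p w| != 1 ->
  exists2 b : X -> nat, (forall i, coprime p (b i)) & p %| \sum_(i in I) b i * w i.
Proof.
move=> p_pr p_odd M1.
have [M0 | [j]] := set_0Vmem (I :&: coprime_terms p w).
  exists (fun=> 1) => [i|]; first exact: coprimen1.
  apply: dvdn_sum => i iI; rewrite mul1n; apply: contraT => pwi.
  by have := in_set0 i; rewrite -M0 !inE iI pwi.
move=> jM; have [k] : exists k, k \in (I :&: coprime_terms p w) :\ j.
  by apply/card_gt0P; move: M1; rewrite (cardsD1 j) jM; case: #|_|.
move: jM; rewrite !inE => /andP[jI pwj] /and3P[kj kI pwk].
pose rest := \sum_(i in I :\ j :\ k) w i.
(* One of the weights 1 and 2 works: the two sums differ by [w k], and 2 is prime to [p]. *)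
have [y [yp ycop]] : exists y, coprime p y /\ ~~ (p %| y * w k + rest).
  have [pd | pd] := boolP (p %| 1 * w k + rest); last by exists 1; rewrite coprimen1.
  exists 2; split; first by rewrite coprimen2.
  by rewrite (mulnDl 1 1) -addnA dvdn_addl // mul1n.
have [||x px] := @coprime_solve_dvdn (w j) p (y * w k + rest).
- exact: prime_gt0.
- by rewrite coprime_sym prime_coprime.
have xp : coprime p x.
  rewrite prime_coprime //; apply: contra ycop => pdx.
  by rewrite -(dvdn_addr _ (dvdn_mulr (w j) pdx)).
exists (fun i => if i == j then x else if i == k then y else 1).
  by move=> i; do 2?case: ifP => // _; exact: coprimen1.
rewrite (big_setD1 j) //= eqxx (big_setD1 k) ?inE ?kj //= (negbTE kj) eqxx.
rewrite (eq_bigr w) // => i; rewrite !inE => /and3P[/negbTE-> /negbTE-> _].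
by rewrite mul1n.
Qed.

Local Open Scope ring_scope.

(** * Lifting to ['Z_n] and the upper bound for the Gao constant *)

Lemma Zn_nat_eq0 (n m : nat) : (1 < n)%N -> (m%:R == 0 :> 'Z_n) = (n %| m)%N.
Proof. by move=> n_gt1; rewrite -val_eqE /= val_Zp_nat. Qed.

Lemma Zn_int_eq0 (n : nat) (z : int) :
  (1 < n)%N -> (z%:~R == 0 :> 'Z_n) = (n %| `|z|)%N.
Proof.
move=> n_gt1; case: z => m; first by rewrite -pmulrn Zn_nat_eq0.
by rewrite NegzE mulrNz oppr_eq0 -pmulrn Zn_nat_eq0.
Qed.

Lemma zero_sum_of_residues (n r p : nat) (S : seq 'Z_n) (I : {set 'I_(size S)})
    (w := fun i : 'I_(size S) => nat_of_ord S`_i) :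
  prime p -> odd p -> n = (2 ^ r * p)%N -> I != set0 ->
  odd_weighted_zero_sum r w I -> #|I :&: coprime_terms p w| != 1%N ->
  weighted_zero_sum (Zn_units n) I.
Proof.
move=> p_pr p_odd n_def I0 [a a_odd sa].
case/(coprime_weighted_zero_sum p_pr p_odd) => b b_cop pb; split=> //.
have n_gt1 : (1 < n)%N.
  by rewrite n_def (leq_trans (prime_gt1 p_pr)) // leq_pmull // expn_gt0.
have cop : coprime (2 ^ r) p by rewrite coprimeXl // coprime2n.
pose c i := chinese (2 ^ r) p (a i) (b i).
exists (fun i => (c i)%:R); split=> [i _|].
  rewrite inE unitZpE // n_def coprimeMl -coprime_modr (chinese_modl cop).
  rewrite coprime_modr -[X in _ && X]coprime_modr (chinese_modr cop).
  by rewrite coprime_modr b_cop andbT coprimeXl // coprime2n.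
rewrite (eq_bigr (fun i => (c i * w i)%N%:R)); last first.
  by move=> i _; rewrite natrM natr_Zp.
apply/eqP; rewrite -natr_sum Zn_nat_eq0 // (congr1 (dvdn^~ _) n_def) Gauss_dvd //.
have modS d (f g : 'I_(size S) -> nat) : (forall i, f i = g i %[mod d])%N ->
    (d %| \sum_(i in I) f i * w i)%N = (d %| \sum_(i in I) g i * w i)%N.
  move=> fg; rewrite /dvdn -modn_summ -[in RHS]modn_summ; congr (_ %% _ == _)%N.
  by apply: eq_bigr => i _; rewrite -modnMml fg modnMml.
rewrite (modS _ _ a) => [|i]; last exact: chinese_modl.
by rewrite sa (modS _ _ b) // => i; apply: chinese_modr.
Qed.

(** One term may be lost at each of the [r] levels, and one more for being the only term prime to
    [p]. *)
Lemma gao_property_upper (n r p : nat) :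
  prime p -> odd p -> (0 < r)%N -> n = (2 ^ r * p)%N ->
  gao_property (Zn_units n) (n + r).+1.
Proof.
move=> p_pr p_odd r_gt0 n_def S sS.
have n_gt3 : (3 < n)%N.
  have := prime_gt1 p_pr; rewrite n_def -(prednK r_gt0) expnS.
  by have := expn_gt0 2 r.-1; case: p p_odd {p_pr n_def} => [|[|[|p]]] //; nia.
have n_ev : ~~ odd n by rewrite n_def oddM oddX eqn0Ngt r_gt0.
pose w (i : 'I_(size S)) := nat_of_ord S`_i.
have cT : (n + r < #|[set: 'I_(size S)]|)%N by rewrite cardsT card_ord sS.
have [I [_ In zI MI]] := @odd_weighted_zero_sum_unmarked_exists _ n r
  w _ (coprime_terms p w) n_gt3 n_ev cT.
exists I; split=> //; apply: (zero_sum_of_residues p_pr p_odd n_def) => //.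
by rewrite -card_gt0 In; apply: leq_trans n_gt3.
Qed.

(** * Transfer of zero sums, and the model sequence *)

(** Covers both inclusion of a subsequence, with [u = 1], and weighted equivalence. *)
Lemma has_zero_sum_transfer (n : nat) (S T : seq 'Z_n)
    (f : 'I_(size S) -> 'I_(size T)) (u : 'I_(size S) -> 'Z_n) :
  injective f -> (forall i, u i \is a GRing.unit) ->
  (forall i : 'I_(size S), S`_i = u i * T`_(f i)) ->
  has_zero_sum_of_length_n (Zn_units n) S ->
  has_zero_sum_of_length_n (Zn_units n) T.
Proof.
move=> f_inj u_unit uE [I [[I0 [a [a_unit a0]]] In]].
exists (f @: I); split; last by rewrite card_imset.
split; first by rewrite imset_eq0.
(* The [pick] inverts [f]; the default 1 is never met on [f @: I]. *)
exists (fun j => if [pick i | f i == j] is Some i then a i * u i else 1).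
have pickf i : [pick i' | f i' == f i] = Some i.
  by case: pickP => [i' /eqP/f_inj-> | /(_ i)/eqP].
split=> [j /imsetP[i iI ->]|].
  by rewrite pickf inE unitrM u_unit andbT; have := a_unit i iI; rewrite inE.
rewrite big_imset /=; last by move=> i i' _ _; apply: f_inj.
by rewrite -[RHS]a0; apply: eq_bigr => i _; rewrite pickf uE mulrA.
Qed.

Definition prefix_prod (r : nat) (q : 'I_r -> nat) (k : nat) : nat :=
  (\prod_(j < r | j < k) q j)%N.

Lemma prefix_prodS (r : nat) (q : 'I_r -> nat) (i : 'I_r) :
  prefix_prod q i.+1 = (prefix_prod q i * q i)%N.
Proof.
rewrite /prefix_prod (bigD1 i) //= mulnC; congr (_ * _)%N.
by apply: eq_bigl => j; rewrite ltnS ltn_neqAle andbC.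
Qed.

Lemma prefix_prod_full (r : nat) (q : 'I_r -> nat) :
  prefix_prod q r = (\prod_(j < r) q j)%N.
Proof. by apply: eq_bigl => j; rewrite ltn_ord. Qed.

Lemma dvdn_prefix_prod (r : nat) (q : 'I_r -> nat) (k l : nat) :
  (k <= l)%N -> (prefix_prod q k %| prefix_prod q l)%N.
Proof.
move=> kl; rewrite [X in (_ %| X)%N](bigID (fun j : 'I_r => j < k)%N) /=.
rewrite [X in (_ %| X * _)%N](eq_bigl (fun j : 'I_r => j < k)%N) ?dvdn_mulr // => j.
by case: (ltnP j k) => jk; rewrite ?andbF ?andbT // (leq_trans jk kl).
Qed.

Lemma size_model_sequence (n r : nat) (q : 'I_r -> nat) (b : 'I_r -> int) (m : nat) :
  (m <= n)%N -> size (model_sequence n q b m) = (r + n)%N.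
Proof.
by move=> mn; rewrite !size_cat size_map !size_nseq size_enum_ord subnKC.
Qed.

Lemma nth_model_sequence_head (n r : nat) (q : 'I_r -> nat) (b : 'I_r -> int)
    (m : nat) (i : 'I_r) :
  (model_sequence n q b m)`_i = (prefix_prod q i)%:R * (b i)%:~R.
Proof.
rewrite nth_cat size_map size_enum_ord ltn_ord (nth_map i) ?size_enum_ord //.
by rewrite nth_ord_enum.
Qed.

Lemma nth_model_sequence_tail (n r : nat) (q : 'I_r -> nat) (b : 'I_r -> int)
    (m j : nat) :
  (r <= j)%N ->
  (model_sequence n q b m)`_j = if (j < r + m)%N then (n %/ 2)%:R else 0.
Proof.
move=> rj; rewrite nth_cat size_map size_enum_ord ltnNge rj /=.
rewrite nth_cat size_nseq !nth_nseq -(_ : (j - r < m) = (j < r + m))%N; last by lia.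
by case: (j - r < m)%N => //; case: ifP.
Qed.

(* A unit-weighted zero-sum subsequence cannot use any of the first r terms:
   if the first one used has index i, multiplying the relation by
   n / (q_0 ... q_i) kills every other term. What remains are m copies of n/2,
   which sum to n/2 as m is odd. *)
Lemma model_sequence_no_zero_sum (n r : nat) (q : 'I_r -> nat) (b : 'I_r -> int)
    (m : nat) :
  (forall i, prime (q i)) -> n = (2 * \prod_(i < r) q i)%N ->
  (forall i, coprimez (b i) (Posz (q i))) -> odd m -> (m <= n)%N ->
  ~ has_zero_sum_of_length_n (Zn_units n) (model_sequence n q b m).
Proof.
move=> q_pr n_def b_cop m_odd mn [J [[_ [a [a_unit a0]]] Jn]].
have sT := size_model_sequence q b mn.
set T := model_sequence n q b m in J a a_unit a0 Jn sT *.
have prodE : prefix_prod q r = (n %/ 2)%N by rewrite prefix_prod_full n_def mulKn.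
have n_gt1 : (1 < n)%N.
  have : (0 < \prod_(i < r) q i)%N by rewrite prodn_gt0 // => i; apply: prime_gt0.
  by rewrite n_def; lia.
have n2 : n = (2 * (n %/ 2))%N by rewrite -prodE prefix_prod_full.
have dvd_n k : (k <= r)%N -> (prefix_prod q k %| n)%N.
  by move=> kr; rewrite n2 dvdn_mull // -prodE dvdn_prefix_prod.
have headN k : (k < r)%N -> forall j : 'I_(size T), j \in J -> j != k :> nat.
  have [t kt] := ubnP k; elim: t k kt => // t IHt k kt kr j jJ.
  apply/eqP => jk; pose i := Ordinal kr.
  pose P := prefix_prod q i.+1; pose d := (n %/ P)%N.
  have dP : n = (d * P)%N by rewrite divnK // dvd_n.
  have killed (x : 'Z_n) l : (i < l <= r)%N -> d%:R * ((prefix_prod q l)%:R * x) = 0.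
    case/andP=> il _; have /dvdnP[e ->] := dvdn_prefix_prod q il.
    apply/eqP; rewrite mulrA -natrM mulnCA -/P -dP natrM.
    by rewrite (_ : n%:R = 0) ?mulr0 ?mul0r //; apply/eqP; rewrite Zn_nat_eq0.
  have : d%:R * \sum_(l in J) a l * T`_l = 0 by rewrite a0 mulr0.
  rewrite (big_setD1 j) //= mulrDr big_distrr /= big1 ?addr0 => [|l].
    rewrite jk -[k]/(nat_of_ord i) nth_model_sequence_head mulrCA.
    have := a_unit j jJ; rewrite inE => aj /(canRL (mulKr aj)); rewrite mulr0.
    rewrite mulrA -natrM pmulrn -intrM => /eqP; rewrite Zn_int_eq0 // abszM absz_nat.
    rewrite {1}dP /P prefix_prodS mulnA dvdn_pmul2l; last first.
      have := ltnW n_gt1; rewrite {1}dP /P prefix_prodS mulnA.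
      by rewrite !muln_gt0 => /andP[].
    move=> qb; have := b_cop i; rewrite /coprimez /gcdz /= eqz_nat -/(coprime _ _).
    by rewrite coprime_sym prime_coprime // qb.
  rewrite !inE => /andP[lj lJ]; rewrite mulrCA.
  have il : (k < l)%N.
    rewrite ltn_neqAle; apply/andP; split.
      by apply: contra lj => /eqP kl; apply/eqP/val_inj; rewrite /= -kl.
    rewrite leqNgt; apply/negP => lk.
    by have /eqP := IHt l (leq_trans lk kt) (ltn_trans lk kr) l lJ.
  have [lr | rl] := ltnP l r.
    rewrite -[nat_of_ord l]/(nat_of_ord (Ordinal lr)) nth_model_sequence_head.
    by rewrite killed ?mulr0 //= il ltnW.
  rewrite nth_model_sequence_tail // -prodE; case: ifP => _; last by rewrite !mulr0.
  by rewrite -[(prefix_prod q r)%:R]mulr1 killed ?mulr0 //= kr leqnn.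
(* [J] has [n] elements and avoids the first [r] of the [r + n] indices, so it contains all
   others. *)
have JE : J = [set j : 'I_(size T) | (r <= j)%N].
  apply/eqP; rewrite eqEcard; apply/andP; split.
    apply/subsetP=> j jJ; rewrite inE leqNgt; apply/negP => jr.
    by have /eqP := headN j jr j jJ.
  rewrite Jn -sum1_card (eq_bigl (fun j : 'I_(size T) => true && (r <= j)%N)).
    rewrite -(big_geq_mkord _ _ predT (fun=> 1%N)) sum_nat_const_nat muln1.
    by rewrite sT addKn.
  by move=> j; rewrite inE.
(* Units are odd, and even multiples of [n %/ 2] vanish. *)
have half_fixed x : x \is a GRing.unit -> x * (n %/ 2)%:R = (n %/ 2)%:R :> 'Z_n.
  rewrite -[x]natr_Zp unitZpE // => nx; have x_odd : odd x.
    by rewrite -coprime2n; apply: coprime_dvdl nx; rewrite n2 dvdn_mulr.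
  rewrite -natrM -{1}(odd_double_half x) x_odd mulnDl mul1n -muln2 -mulnA -n2.
  by rewrite natrD natrM [n%:R](_ : _ = 0) ?mulr0 ?addr0 //; apply/eqP; rewrite Zn_nat_eq0.
move: a0; rewrite (eq_bigr (fun j : 'I_(size T) =>
    if (j < r + m)%N then (n %/ 2)%:R else 0)); last first.
  move=> j jJ; have := a_unit j jJ; rewrite inE => aj.
  move: jJ; rewrite JE inE => /nth_model_sequence_tail->.
  by case: ifP => _; rewrite ?mulr0 // half_fixed.
rewrite JE (eq_bigl (fun j : 'I_(size T) => true && (r <= j)%N)); last first.
  by move=> j; rewrite inE.
rewrite -(big_geq_mkord _ _ predT (fun j => if (j < r + m)%N then (n %/ 2)%:R else 0)).
rewrite sT (@big_cat_nat _ _ _ (r + m)) ?leq_addr ?leq_add2l //=.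
rewrite [X in _ + X]big_nat_cond [X in _ + X]big1 ?addr0; last first.
  by move=> j /andP[/andP[mj _] _]; rewrite ltnNge mj.
rewrite big_nat (eq_bigr (fun=> (n %/ 2)%:R)); last by move=> j /andP[_ ->].
rewrite -big_nat sumr_const_nat addKn -mulrnA => /eqP; rewrite Zn_nat_eq0 //.
rewrite {1}n2 mulnC dvdn_pmul2l ?dvdn2 ?m_odd //.
by rewrite -prodE prefix_prod_full prodn_gt0 // => i; apply: prime_gt0.
Qed.

(** * The value of the Gao constant *)

(** Otherwise the first [j] terms of [T] would already contain a zero sum. A single bad sequence
    thus bounds the Gao constant from below. *)
Lemma lt_size_gao_property (n j : nat) (T : seq 'Z_n) :
  ~ has_zero_sum_of_length_n (Zn_units n) T -> gao_property (Zn_units n) j ->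
  (size T < j)%N.
Proof.
move=> noT gj; rewrite ltnNge; apply/negP => jT; apply: noT.
have sj : size (take j T) = j by rewrite size_takel.
have le_s : (size (take j T) <= size T)%N by rewrite sj.
apply: (@has_zero_sum_transfer _ (take j T) T (widen_ord le_s) (fun=> 1)).
- by move=> x y /(congr1 val) /= /val_inj.
- by move=> _; apply: unitr1.
- by move=> i; rewrite mul1r nth_take // -{2}sj.
- exact: gj.
Qed.

(** With this order and admissible [b], the first model term is prime to [p], and the next ones are
    multiples of [p] of 2-adic valuations 0, 1, 2 and so on. *)
Definition odd_prime_first (p r : nat) (i : 'I_r) : nat :=
  if i == 0 :> nat then p else 2%N.

Lemma prefix_prod_odd_prime_first (p r k : nat) :
  (k < r)%N -> prefix_prod (@odd_prime_first p r) k.+1 = (2 ^ k * p)%N.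
Proof.
elim: k => [|k IHk] kr; rewrite -[k in k.+1]/(nat_of_ord (Ordinal kr)).
  rewrite prefix_prodS /odd_prime_first /= /prefix_prod big_pred0 //.
rewrite prefix_prodS /= IHk; last exact: ltnW.
by rewrite /odd_prime_first /= expnS mulnC mulnA.
Qed.

Lemma gao_constant_units (n r p : nat) :
  prime p -> odd p -> (0 < r)%N -> n = (2 ^ r * p)%N ->
  is_gao_constant (Zn_units n) (n + r).+1.
Proof.
move=> p_pr p_odd r_gt0 n_def; split=> // [|j _ gj].
  exact: gao_property_upper p_pr p_odd r_gt0 n_def.
have n_gt0 : (0 < n)%N by rewrite n_def muln_gt0 expn_gt0 (prime_gt0 p_pr).
have r1 : (r.-1 < r)%N by rewrite prednK.
(* The lower bound is witnessed by a model sequence of length [r + n], with all [b] equal to 1 and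
   [m = 1]. *)
have noT : ~ has_zero_sum_of_length_n (Zn_units n)
    (model_sequence n (@odd_prime_first p r) (fun=> 1) 1).
  apply: model_sequence_no_zero_sum => //.
  - by move=> i; rewrite /odd_prime_first; case: ifP.
  - rewrite -prefix_prod_full -[in prefix_prod _ r](prednK r_gt0).
    by rewrite prefix_prod_odd_prime_first // mulnA -expnS prednK.
  - by move=> i; rewrite /coprimez /gcdz /= gcd1n.
by have := lt_size_gao_property noT gj; rewrite size_model_sequence // addnC.
Qed.

Lemma gao_extremal_units (n r p : nat) (S : seq 'Z_n) :
  prime p -> odd p -> (0 < r)%N -> n = (2 ^ r * p)%N ->
  gao_extremal (Zn_units n) S <->
  size S = (n + r)%N /\ ~ has_zero_sum_of_length_n (Zn_units n) S.
Proof.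
move=> p_pr p_odd r_gt0 n_def.
have gK := gao_constant_units p_pr p_odd r_gt0 n_def.
split=> [[k [[k0 gk kmin] sS noS]] | [sS noS]].
  case: gK => gK0 gK gKmin; split=> //.
  have := kmin _ gK0 gK; have := gKmin _ k0 gk; rewrite sS; lia.
by exists (n + r).+1; split=> //; rewrite sS subn1.
Qed.

(** * Extremal sequences with two odd terms *)

(** Some zero sum of length [m] exists and meets [M], so [M] is nonempty; two marked terms would
    allow a zero sum with at least two of them. Once [i0] is removed no zero sum of length [m] is
    left, and [level_structure] applies. *)
Lemma two_odd_structure (X : finType) (m s : nat) (w : X -> nat) (M : {set X}) :
  (3 < m)%N -> ~~ odd m -> #|X| = (m + s.+2)%N -> #|odd_terms w| = 2%N ->
  (forall I : {set X}, #|I| = m -> odd_weighted_zero_sum s.+2 w I ->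
     #|I :&: M| = 1%N) ->
  exists i0, [/\ M = [set i0],
    forall v, (v < s.+1)%N -> #|~: [set i0] :&: level v w| = 1%N
    & odd #|~: [set i0] :&: level s.+1 w| ].
Proof.
move=> m3 mev cX o2 noz.
have m0 : (0 < m)%N by apply: leq_trans m3.
have /cards1P[i0 M1] : #|M| == 1%N.
  have cM := cardsID (odd_terms w) M.
  have [M2 | ] := ltnP 1 #|M|; last first.
    have [I [_ Im zI]] := @odd_weighted_zero_sum_exists _ m s.+2 w [set: X] m0 mev
      ltac:(by rewrite cardsT cX).
    by have := subset_leq_card (subsetIr I M); rewrite (noz I Im zI); lia.
  pose O := odd_terms w.
  have cO := cardsID M ([set: X] :&: O); have cE := cardsID M ([set: X] :\: O).
  have cT := cardsID O [set: X].
  move: cT cO cE; rewrite cardsT cX setTI o2 => cT cO cE.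
  have cOM : #|O :&: M| = #|M :&: odd_terms w| by rewrite setIC.
  have cEM : #|([set: X] :\: O) :&: M| = #|M :\: odd_terms w|.
    by apply: eq_card => i; rewrite !inE andbT.
  (* Both odd terms are taken, then as many marked even terms as fit, which makes at least two
     marked terms in all. *)
  have [||||I [_ Im IO IM]] := @subset_of_card4 _ [set: X] O M #|O :&: M|
    (2 - #|O :&: M|) (minn #|M :\: odd_terms w| (m - 2))
    (m - 2 - minn #|M :\: odd_terms w| (m - 2)).
  - by rewrite setTI.
  - by rewrite setTI; lia.
  - by lia.
  - by lia.
  have zI : odd_weighted_zero_sum s.+2 w I.
    have IO2 : #|I :&: odd_terms w| = 2%N by rewrite IO; lia.
    by apply: odd_weighted_zero_sum_even; rewrite IO2.
  have Im' : #|I| = m by rewrite Im; lia.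
  by have := noz I Im' zI; lia.
exists i0; have [||lev1 lev_odd] := @level_structure _ m s.+1 w (~: [set i0]) m0 mev.
- by have := cardsC [set i0]; rewrite cards1 cX; lia.
- move=> I Ii0 Im zI; have := noz I Im zI; rewrite M1.
  suff -> : I :&: [set i0] = set0 by rewrite cards0.
  by apply: disjoint_setI0; rewrite disjoints_subset.
- by [].
Qed.

Lemma level_inj (X : finType) (w : X -> nat) (i : X) (u v : nat) :
  i \in level u w -> i \in level v w -> u = v.
Proof.
wlog uv : u v / (u <= v)%N.
  by move=> IH iu iv; case/orP: (leq_total u v) => /IH; [|move=> IH'; symmetry]; auto.
rewrite !inE => /andP[_ nu] /andP[dv _]; apply/eqP; rewrite eqn_leq uv leqNgt.
by apply: contra nu => {}uv; apply: dvdn_trans dv; apply: dvdn_exp2l.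
Qed.

Lemma level_exists (X : finType) (w : X -> nat) (i : X) (r : nat) :
  ~~ (2 ^ r %| w i)%N -> exists2 v, (v < r)%N & i \in level v w.
Proof.
elim: r => [|r IHr]; first by rewrite dvd1n.
have [dr nr | nr _] := boolP (2 ^ r %| w i)%N; first by exists r; rewrite ?inE ?dr.
by have [v vr iv] := IHr nr; exists v; first exact: ltnW.
Qed.

Lemma level_quotient_odd (X : finType) (w : X -> nat) (i : X) (v p : nat) :
  odd p -> (p %| w i)%N -> i \in level v w ->
  exists2 t, odd t & w i = (2 ^ v * p * t)%N.
Proof.
move=> p_odd pw; rewrite inE => /andP[vw nvw].
have cop : coprime (2 ^ v) p by rewrite coprimeXl // coprime2n.
have /dvdnP[t wE] : (2 ^ v * p %| w i)%N by rewrite Gauss_dvd // vw.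
exists t; last by rewrite wE mulnC.
apply: contraR nvw; rewrite -dvdn2 wE => /dvdnP[u ->].
by apply/dvdnP; exists (u * p)%N; rewrite expnS; lia.
Qed.

Lemma perm_eq_weighted_equiv (n : nat) (S T : seq 'Z_n) :
  perm_eq S T -> weighted_equiv (Zn_units n) S T.
Proof.
move=> ST; have sE := perm_size ST; split=> //.
have sT : size T == size S by rewrite sE.
have [s sP] := @tuple_permP _ _ S (Tuple sT) ST.
exists 1, s, (fun=> 1); split=> [|i|i]; rewrite ?inE ?unitr1 // !mul1r.
rewrite -[RHS](tnth_nth 0 (in_tuple S)).
have -> : in_tuple S = [tuple tnth (Tuple sT) (s i) | i < size S].
  by apply: val_inj.
by rewrite tnth_mktuple (tnth_nth 0).
Qed.

(** The indices split into [i0], one further index on each level up to [s], the set [L] on level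
    [s.+1] where terms equal [n %/ 2], and the set [Z] of zeros. Listing them in this order gives
    the model sequence. *)
Lemma model_sequence_perm (n s p : nat) (S : seq 'Z_n) (i0 : 'I_(size S))
    (w := fun i : 'I_(size S) => nat_of_ord S`_i) :
  prime p -> odd p -> n = (2 ^ s.+2 * p)%N -> size S = (n + s.+2)%N ->
  coprime_terms p w = [set i0] ->
  (forall v, (v < s.+1)%N -> #|~: [set i0] :&: level v w| = 1%N) ->
  odd #|~: [set i0] :&: level s.+1 w| ->
  exists (b : 'I_s.+2 -> int) (m : nat),
    [/\ forall i, coprimez (b i) (Posz (odd_prime_first p i)),
        odd m /\ (1 <= m <= n)%N
      & perm_eq S (model_sequence n (@odd_prime_first p s.+2) b m)].
Proof.
move=> p_pr p_odd n_def sS Mi0 lev1 lev_odd.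
have n_gt1 : (1 < n)%N.
  by rewrite n_def expnS -mulnA; have := prime_gt0 p_pr; have := expn_gt0 2 s.+1; nia.
have pw i : i != i0 -> (p %| w i)%N.
  by apply: contraNT => pwi; rewrite -in_set1 -Mi0 inE.
have pw0 : ~~ (p %| w i0)%N.
  by have := set11 i0; rewrite -Mi0 inE.
(* Position 0 is taken by [i0], so position [j > 0] receives the index of level [j.-1]. *)
have [e eP] : exists e : 'I_s.+2 -> 'I_(size S), forall j : 'I_s.+2,
    if j == 0 :> nat then e j = i0 else e j \in ~: [set i0] :&: level j.-1 w.
  apply: (@fin_all_exists _ _ (fun (j : 'I_s.+2) x =>
    if j == 0 :> nat then x = i0 else x \in ~: [set i0] :&: level j.-1 w)) => j.
  case: (altP (nat_of_ord j =P 0%N)) => j0; first by exists i0.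
  apply/card_gt0P; rewrite lev1 //; have := ltn_ord j.
  by case: (nat_of_ord j) j0.
pose q := @odd_prime_first p s.+2.
(* The cofactor [t] will be the integer [b j]: the term itself at position 0, an odd number
   elsewhere. *)
have e_val j : exists t, [/\ w (e j) = (prefix_prod q j * t)%N & coprime t (q j)].
  have := eP j; rewrite /q {2}/odd_prime_first; case: j => [[|j] jr] /= ej.
    exists (w i0); rewrite ej coprime_sym prime_coprime //.
    by rewrite /prefix_prod big_pred0 // mul1n.
  case/setIP: ej => ej0 ejl; rewrite !inE in ej0.
  have [t t_odd wE] := level_quotient_odd p_odd (pw _ ej0) ejl.
  by exists t; rewrite coprimen2 prefix_prod_odd_prime_first //; exact: ltnW.
have [t tP] := fin_all_exists e_val.
pose L := ~: [set i0] :&: level s.+1 w.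
pose Z := [set i | (n %| w i)%N].
pose l := map e (enum 'I_s.+2) ++ enum L ++ enum Z.
have levNZ i v : (v < s.+2)%N -> i \in level v w -> i \notin Z.
  move=> vs; rewrite !inE => /andP[_]; apply: contra => nw.
  apply: dvdn_trans nw; rewrite n_def dvdn_mulr //; exact: dvdn_exp2l.
have i0NZ : i0 \notin Z.
  by rewrite inE; apply: contra pw0 => /(dvdn_trans _)-> //; rewrite n_def dvdn_mull.
have eP0 (j : 'I_s.+2) : nat_of_ord j = 0%N -> e j = i0.
  by move=> j0; have := eP j; rewrite j0.
have ePS (j : 'I_s.+2) : nat_of_ord j != 0%N -> e j != i0 /\ e j \in level j.-1 w.
  by move=> /negbTE j0; have := eP j; rewrite j0 => /setIP[]; rewrite !inE.
have predj (j : 'I_s.+2) : nat_of_ord j != 0%N -> (j.-1 < s.+1)%N.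
  by have := ltn_ord j; case: (nat_of_ord j).
have e_inj : injective e.
  move=> j k ejk; apply: val_inj => /=.
  have [j0 | j0] := altP (nat_of_ord j =P 0%N);
    have [k0 | k0] := altP (nat_of_ord k =P 0%N).
  - by rewrite j0 k0.
  - by have [] := ePS k k0; rewrite -ejk (eP0 j) // eqxx.
  - by have [] := ePS j j0; rewrite ejk (eP0 k) // eqxx.
  have [_ jl] := ePS j j0; have [_ kl] := ePS k k0.
  rewrite ejk in jl; have := level_inj jl kl.
  by case: (nat_of_ord j) j0 => // j' _; case: (nat_of_ord k) k0 => //= k' _ ->.
have lP : perm_eq l (enum 'I_(size S)).
  apply: uniq_perm; last 1 first.
  - move=> i; rewrite mem_enum !mem_cat !mem_enum.
    have [-> | i_i0] := eqVneq i i0.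
      by rewrite -(eP0 ord0) // map_f // mem_enum.
    (* Away from [i0] every term is a multiple of [p], so divisibility by [2 ^ s.+2] already makes
       it 0 modulo [n]. *)
    have [wi | nwi] := boolP (2 ^ s.+2 %| w i)%N.
      rewrite [i \in Z]inE (congr1 (dvdn^~ (w i)) n_def).
      rewrite Gauss_dvd ?wi ?pw ?orbT //.
      by rewrite coprimeXl // coprime2n.
    have [v vs iv] := level_exists nwi; have [vs1 | vs1] := ltnP v s.+1.
      have [x xE] := cards1P (introT eqP (lev1 v vs1)).
      have : i \in [set x] by rewrite -xE !inE i_i0; rewrite inE in iv.
      have := eP (@Ordinal s.+2 v.+1 vs1); rewrite /= xE => /set1P <- /set1P ->.
      by rewrite map_f // mem_enum.
    have vE : v = s.+1 by apply/eqP; rewrite eqn_leq vs1 andbT.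
    by rewrite vE in iv; rewrite [i \in L]inE in_setC1 i_i0 iv orbT.
  - rewrite cat_uniq map_inj_uniq // enum_uniq cat_uniq !enum_uniq andbT /=.
    apply/andP; split.
      apply/hasPn => i; rewrite mem_cat !mem_enum => iLZ; apply/mapP => -[j _ ij].
      have [j0 | j0] := altP (nat_of_ord j =P 0%N).
        by move: iLZ; rewrite ij eP0 // (negbTE i0NZ) orbF !inE eqxx.
      have [_ jl] := ePS j j0; have js := predj j j0.
      move: iLZ; rewrite ij (negbTE (levNZ _ _ (ltnW js) jl)) orbF => /setIP[_ jl'].
      by move: js; rewrite (level_inj jl jl') ltnn.
    apply/hasPn => i; rewrite !mem_enum => iZ; apply: contraL iZ => /setIP[_].
    exact: levNZ.
  - exact: enum_uniq.
have nS : perm_eq S (map (fun i : 'I_(size S) => S`_i) l).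
  rewrite perm_sym; apply: perm_trans (perm_map _ lP) _.
  rewrite (map_comp (nth 0 S) val) val_enum_ord; have := mkseq_nth 0 S.
  by rewrite /mkseq => ->.
(* The list [l] has [n + s.+2] entries, of which [s.+2] come from [e]. *)
have mZ : (#|L| + #|Z|)%N = n.
  have := perm_size lP; rewrite !size_cat size_map !size_enum_ord -!cardE; lia.
exists (fun j => Posz (t j)), #|L|; split.
- by move=> j; have [_] := tP j; rewrite /coprimez /gcdz /=.
- by split=> //; move: lev_odd mZ; rewrite -/L; lia.
apply: perm_trans nS _; rewrite /l !map_cat.
have natS (i : 'I_(size S)) : S`_i = (w i)%:R by rewrite natr_Zp.
have -> : [seq S`_(i : 'I_(size S)) | i <- enum L] = nseq #|L| (n %/ 2)%:R.
  rewrite cardE -(size_map (fun i : 'I_(size S) => S`_i)); apply/all_pred1P/allP.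
  move=> x /mapP[i]; rewrite mem_enum => /setIP[ii0 il] ->.
  rewrite !inE in ii0; have [u u_odd wE] := level_quotient_odd p_odd (pw _ ii0) il.
  have n2 : n = (2 * (2 ^ s.+1 * p))%N by rewrite n_def expnS mulnA.
  (* The term is an odd multiple of [n %/ 2], hence equal to it modulo [n]. *)
  rewrite /= natS wE -(odd_double_half u) u_odd mulnDr muln1 natrD.
  have -> : (n %/ 2)%N = (2 ^ s.+1 * p)%N by rewrite n2 mulKn.
  rewrite -subr_eq0 addrC addKr Zn_nat_eq0 // -mul2n mulnCA mulnA -n2.
  exact: dvdn_mulr.
have -> : [seq S`_(i : 'I_(size S)) | i <- enum Z] = nseq (n - #|L|)%N 0.
  have -> : (n - #|L|)%N = #|Z| by lia.
  rewrite cardE -(size_map (fun i : 'I_(size S) => S`_i)); apply/all_pred1P/allP.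
  move=> x /mapP[i]; rewrite mem_enum inE => iZ ->.
  by rewrite /= natS Zn_nat_eq0.
suff -> : [seq S`_(i : 'I_(size S)) | i <- map e (enum 'I_s.+2)] =
    [seq (prefix_prod q i)%:R * (Posz (t i))%:~R | i : 'I_s.+2 <- enum 'I_s.+2] by [].
rewrite -map_comp; apply: eq_map => j /=.
by have [wE _] := tP j; rewrite natS wE natrM -pmulrn.
Qed.

Theorem theorem5 (n r p : nat) (S : seq 'Z_n)
    (p_prime : prime p) (p_odd : odd p) (r_ge2 : (2 <= r)%N)
    (n_def : n = (2 ^ r * p)%N)
    (S_two_odd : count (@Zn_odd n) S = 2%N) :
  gao_extremal (Zn_units n) S <->
  exists (q : 'I_r -> nat) (b : 'I_r -> int) (m : nat),
    [/\ forall i, prime (q i),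
        n = (2 * \prod_(i < r) q i)%N,
        forall i, coprimez (b i) (Posz (q i)),
        odd m /\ (1 <= m <= n)%N
      & weighted_equiv (Zn_units n) S (model_sequence n q b m)].
Proof.
have r_gt0 : (0 < r)%N := ltnW r_ge2.
apply: iff_trans (gao_extremal_units S p_prime p_odd r_gt0 n_def) _.
split=> [[sS noS] | [q [b [m [q_pr n_prod b_cop [m_odd /andP[_ mn]]]]]]]; last first.
  move=> [sST [c [s [a [c_unit a_unit aE]]]]]; rewrite inE in c_unit.
  split; first by rewrite sST size_model_sequence // addnC.
  have noT := model_sequence_no_zero_sum q_pr n_prod b_cop m_odd mn.
  apply: contra_not noT; set T := model_sequence n q b m in sST aE *.
  (* Solving the equivalence for the terms of [S] gives the unit factors [(a i)^-1 * c]. *)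
  apply: (@has_zero_sum_transfer _ S T (fun i => cast_ord sST (s i))
    (fun i => (a i)^-1 * c)) => [|i|i].
  - by move=> i j /cast_ord_inj /perm_inj.
  - by have := a_unit i; rewrite inE unitrM unitrV c_unit => ->.
  - by have := a_unit i; rewrite inE -mulrA aE => /mulKr->.
have [s rE] : exists s, r = s.+2 by exists r.-2; lia.
subst r; have n_gt3 : (3 < n)%N.
  have := prime_gt1 p_prime; have := expn_gt0 2 s.
  by rewrite n_def !expnS; nia.
have n_ev : ~~ odd n by rewrite n_def oddM oddX.
pose w (i : 'I_(size S)) := nat_of_ord S`_i.
have odd2 : #|odd_terms w| = 2%N.
  rewrite -S_two_odd -sum1_count (big_nth 0) big_mkord -sum1_card.
  by apply: eq_bigl => i; rewrite inE.
have cS : #|'I_(size S)| = (n + s.+2)%N by rewrite card_ord.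
have [|i0 [Mi0 lev1 lev_odd]] :=
    @two_odd_structure _ n s w (coprime_terms p w) n_gt3 n_ev cS odd2.
  (* If the number of terms prime to [p] were not 1, the sum modulo [2 ^ s.+2] would lift to a zero
     sum in ['Z_n]. *)
  move=> I In zI; apply/eqP; apply: contra_notT noS => MI; exists I; split=> //.
  apply: (zero_sum_of_residues p_prime p_odd n_def) => //.
  by rewrite -card_gt0 In (leq_trans _ n_gt3).
have [b [m [b_cop m_odd ST]]] :=
  model_sequence_perm p_prime p_odd n_def sS Mi0 lev1 lev_odd.
exists (@odd_prime_first p s.+2), b, m; split=> //.
- by move=> i; rewrite /odd_prime_first; case: ifP.
- by rewrite -prefix_prod_full prefix_prod_odd_prime_first // mulnA -expnS.
- exact: perm_eq_weighted_equiv.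
Qed.
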